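(* Let $X$ be a set and $M(X)$ the set of multirelations over $X$. Then $(M(X),\cup,\cdot,\|,\emptyset,1_\sigma,1_\pi,a,{}^\ast)$ is an ap-bi-Kleene algebra.
   Context: A multirelation over $X$ is a subset of $X\times 2^X$. For multirelations $R,S$: $R\cdot S=\{(a,A)\mid \exists B.\,(a,B)\in R\wedge\exists f:B\to 2^X.\,(\forall b\in B.\,(b,f(b))\in S)\wedge A=\bigcup_{b\in B}f(b)\}$; $1_\sigma=\{(a,\{a\})\mid a\in X\}$; $R\|S=\{(a,A\cup B)\mid (a,A)\in R,(a,B)\in S\}$; $1_\pi=\{(a,\emptyset)\mid a\in X\}$; $a(R)=\{(a,\{a\})\mid \neg\exists A.\,(a,A)\in R\}$; $R^\ast$ is the least fixpoint (w.r.t. $\subseteq$) of $T\mapsto 1_\sigma\cup R\cdot T$ on $M(X)$. An ap-bi-Kleene algebra is a structure $(S,+,\cdot,\|,0,1_\sigma,1_\pi,a,{}^\ast)$ where: $+$ is associative, commutative, idempotent with unit $0$ (order $x\le y\iff x+y=y$); $1_\sigma\cdot x=x=x\cdot 1_\sigma$, $x\cdot y+x\cdot z\le x\cdot(y+z)$, $(x+y)\cdot z=x\cdot z+y\cdot z$, $0\cdot x=0$; $\|$ is associative, commutative with unit $1_\pi$, $x\|(y+z)=x\|y+x\|z$, $x\|0=0$; $x\cdot(y\cdot z)=(x\cdot y)\cdot z$ whenever one of $x,y,z$ is of the form $a(w)$; $a(x)\cdot x=0$, $a(x\cdot y)=a(x\cdot a(a(y)))$, $a(x)+a(a(x))=1_\sigma$,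 $a(x)\cdot(y+z)=a(x)\cdot y+a(x)\cdot z$; $(x\|y)\cdot a(z)=(x\cdot a(z))\|(y\cdot a(z))$, $a(x\|y)=a(x)+a(y)$, $a(x)\|a(y)=a(x)\cdot a(y)$; $1_\sigma+x\cdot x^\ast\le x^\ast$ and $a(z)+x\cdot y\le y\Rightarrow x^\ast\cdot a(z)\le y$. *)

(* Defs.v *)
From mathcomp Require Import all_boot.
From mathcomp Require Import boolp classical_sets.

Set Implicit Arguments.
Unset Strict Implicit.
Unset Printing Implicit Defensive.

Local Open Scope classical_set_scope.

Definition multirel (X : Type) : Type := set (X * set X).

(* The choice function f : B -> 2^X is a total function on X whose values
   outside B are irrelevant. *)
Definition mseq (X : Type) (R S : multirel X) : multirel X :=
  [set p | exists B : set X, R (p.1, B) /\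
     exists f : X -> set X,
       (forall b, B b -> S (b, f b)) /\ p.2 = \bigcup_(b in B) f b].

Definition mpar (X : Type) (R S : multirel X) : multirel X :=
  [set p | exists A B : set X,
     [/\ R (p.1, A), S (p.1, B) & p.2 = A `|` B]].

Definition mone_sigma (X : Type) : multirel X := [set p | p.2 = [set p.1]].
Arguments mone_sigma X : clear implicits.

Definition mone_pi (X : Type) : multirel X := [set p | p.2 = set0].
Arguments mone_pi X : clear implicits.

Definition mantidom (X : Type) (R : multirel X) : multirel X :=
  [set p | p.2 = [set p.1] /\ ~ exists A : set X, R (p.1, A)].

Definition is_least_fixpoint (T : Type) (F : set T -> set T) (A : set T) : Prop :=
  F A = A /\ forall B : set T, F B = B -> A `<=` B.

Definition mstar_fun (X : Type) (R T : multirel X) : multirel X :=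
  mone_sigma X `|` mseq R T.

(* The default value set0 is never used: see mstarP. *)
Definition mstar (X : Type) (R : multirel X) : multirel X :=
  xget set0 [set T | is_least_fixpoint (mstar_fun R) T].

Lemma mstar_fun_mono (X : Type) (R S T : multirel X) :
  S `<=` T -> mstar_fun R S `<=` mstar_fun R T.
Proof.
move=> ST p [?|[B [RB [f [fS pE]]]]]; first by left.
by right; exists B; split => //; exists f; split => // b /fS /ST.
Qed.

Lemma mstarP (X : Type) (R : multirel X) :
  is_least_fixpoint (mstar_fun R) (mstar R).
Proof.
apply: (@xgetPex _ _ [set T | is_least_fixpoint (mstar_fun R) T]).
pose L := \bigcap_(T in [set T | mstar_fun R T `<=` T]) T.
have leL : mstar_fun R L `<=` L.
  move=> p FLp T FT; apply: (FT); apply: mstar_fun_mono FLp => q.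
  exact.
exists L; split.
  by rewrite eqEsubset; split=> // p; apply; exact: mstar_fun_mono.
by move=> B FB p; apply; rewrite /= FB.
Qed.

Definition add_le (S : Type) (add : S -> S -> S) (x y : S) : Prop := add x y = y.

Record is_ap_bi_Kleene_algebra (S : Type) (add mul par : S -> S -> S)
    (zero sone pone : S) (a star : S -> S) : Prop := {
  apbk_addA : forall x y z, add x (add y z) = add (add x y) z;
  apbk_addC : forall x y, add x y = add y x;
  apbk_addxx : forall x, add x x = x;
  apbk_add0x : forall x, add zero x = x;
  apbk_mul1x : forall x, mul sone x = x;
  apbk_mulx1 : forall x, mul x sone = x;
  apbk_mulDr :
    forall x y z, add_le add (add (mul x y) (mul x z)) (mul x (add y z));
  apbk_mulDl : forall x y z, mul (add x y) z = add (mul x z) (mul y z);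
  apbk_mul0x : forall x, mul zero x = zero;
  apbk_parA : forall x y z, par x (par y z) = par (par x y) z;
  apbk_parC : forall x y, par x y = par y x;
  apbk_par1x : forall x, par pone x = x;
  apbk_parDr : forall x y z, par x (add y z) = add (par x y) (par x z);
  apbk_parx0 : forall x, par x zero = zero;
  apbk_mulA : forall x y z,
    [\/ exists w, x = a w, exists w, y = a w | exists w, z = a w] ->
    mul x (mul y z) = mul (mul x y) z;
  apbk_antidom_mul : forall x, mul (a x) x = zero;
  apbk_antidom_loc : forall x y, a (mul x y) = a (mul x (a (a y)));
  apbk_antidom_compl : forall x, add (a x) (a (a x)) = sone;
  apbk_antidom_mulDr : forall x y z,
    mul (a x) (add y z) = add (mul (a x) y) (mul (a x) z);
  apbk_par_mul_antidom : forall x y z,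
    mul (par x y) (a z) = par (mul x (a z)) (mul y (a z));
  apbk_antidom_par : forall x y, a (par x y) = add (a x) (a y);
  apbk_par_antidom : forall x y, par (a x) (a y) = mul (a x) (a y);
  apbk_star_unfold :
    forall x, add_le add (add sone (mul x (star x))) (star x);
  apbk_star_ind :
    forall x y z, add_le add (add (a z) (mul x y)) y ->
    add_le add (mul (star x) (a z)) y
}.

(* Main.v *)
Require Import Defs.
From mathcomp Require Import all_boot.
From mathcomp Require Import boolp classical_sets.

Set Implicit Arguments.
Unset Strict Implicit.
Unset Printing Implicit Defensive.

Local Open Scope classical_set_scope.

(** Every antidomain element is a subidentity [{(a, {a}) | P a}]. Multiplying by
    it on the left restricts the first component to [P], and on the right keeps
    the pairs [(a, A)] with [A] included in [P]; these two descriptions give all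
    axioms that mention the antidomain. For star induction, [x^* . a(z)] lies
    below [y] because [{(a, A) | A `<=` P -> y (a, A)}] is a pre-fixpoint of
    [T |-> 1_sigma + x . T], where [P] is the set of points described by [a(z)]. *)

Section Multirelations.
Variable X : Type.
Implicit Types (R S T : multirel X) (P Q A B : set X).

Lemma multirel_ext R S : (forall a A, R (a, A) <-> S (a, A)) -> R = S.
Proof. by move=> RS; apply/seteqP; split=> -[a A] /RS. Qed.

Definition dom R : set X := [set a | exists A, R (a, A)].

Definition subid P : multirel X := [set p | p.2 = [set p.1] /\ P p.1].

Lemma subidP P a A : subid P (a, A) <-> A = [set a] /\ P a.
Proof. by []. Qed.

Lemma subid_setT : subid setT = mone_sigma X.
Proof. by apply: multirel_ext => a A; split=> [[]|]. Qed.

Lemma subidU P Q : subid P `|` subid Q = subid (P `|` Q).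
Proof.
apply: multirel_ext => a A; split.
  by move=> [[? ?]|[? ?]]; split=> //; [left|right].
by move=> [? [?|?]]; [left|right].
Qed.

Lemma mantidomE R : mantidom R = subid (~` dom R).
Proof. by []. Qed.

Lemma dom_subid P : dom (subid P) = P.
Proof. by apply/seteqP; split=> [a [A []]//|a Pa]; exists [set a]. Qed.

(** Double antidomain is thus the domain operation, encoded as a subidentity. Locality and the
    complement axiom are reduced to sets of points through it. *)
Lemma mantidomK R : mantidom (mantidom R) = subid (dom R).
Proof. by rewrite !mantidomE dom_subid setCK. Qed.

Lemma mseq_subidl P S a A : mseq (subid P) S (a, A) <-> P a /\ S (a, A).
Proof.
split=> [[B [/subidP[-> Pa] [f [fS /= ->]]]]|[Pa Sa]].
  by rewrite bigcup_set1; split=> //; exact: fS.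
exists [set a]; split=> //; exists (fun=> A); rewrite bigcup_set1; split=> //.
by move=> b ->.
Qed.

(** On the intermediate set [B] the function [f] must be [b] to [[set b]], so the union of its
    values is [B] itself. *)
Lemma mseq_subidr R P a A : mseq R (subid P) (a, A) <-> R (a, A) /\ A `<=` P.
Proof.
split=> [[B [RB [f [fP /= ->]]]]|[RA AP]].
  suff -> : \bigcup_(b in B) f b = B by split=> // b /fP[].
  have fE b : B b -> f b = [set b] by move=> /fP[].
  by rewrite (eq_bigcupr fE) bigcup_imset1 image_id.
exists A; split=> //; exists (fun b => [set b]).
by split=> [b /AP//|/=]; rewrite bigcup_imset1 image_id.
Qed.

(** The domain of a product sees [S] only through [dom S], which is what locality of the antidomain
    rests on. The inclusion from right to left needs the axiom of choice. *)
Lemma dom_mseq R S : dom (mseq R S) = [set a | exists B, R (a, B) /\ B `<=` dom S].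
Proof.
apply/seteqP; split=> [a [A [B [RB [f [fS _]]]]]|a [B [RB BS]]].
  by exists B; split=> // b /fS; exists (f b).
have [f fS] : {f : X -> set X & forall b, B b -> S (b, f b)}.
  (* Guarding by [B b] makes the relation total; outside [B] any value works, here [set0]. *)
  apply: (@choice _ _ (fun b C => B b -> S (b, C))) => b.
  by have [/BS[C SC]|nB] := pselect (B b); [exists C|exists set0].
by exists (\bigcup_(b in B) f b), B; split=> //; exists f.
Qed.

Lemma dom_mpar R S : dom (mpar R S) = dom R `&` dom S.
Proof.
apply/seteqP; split=> [a [C [A [B [RA SB _]]]]|a [[A RA] [B SB]]].
  by split; [exists A|exists B].
by exists (A `|` B), A, B.
Qed.

Lemma mseq1l R : mseq (mone_sigma X) R = R.
Proof.
by rewrite -subid_setT; apply: multirel_ext => a A; rewrite mseq_subidl; split=> [[]|].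
Qed.

Lemma mseq1r R : mseq R (mone_sigma X) = R.
Proof.
by rewrite -subid_setT; apply: multirel_ext => a A; rewrite mseq_subidr; split=> [[]|].
Qed.

Lemma mseqS R S T : S `<=` T -> mseq R S `<=` mseq R T.
Proof.
move=> ST p [B [RB [f [fS pE]]]]; exists B; split=> //; exists f.
by split=> // b /fS/ST.
Qed.

Lemma mseqUl R S T : mseq (R `|` S) T = mseq R T `|` mseq S T.
Proof.
apply: multirel_ext => a A; split=> [[B [[HB|HB] Bf]]|[[B [HB Bf]]|[B [HB Bf]]]].
- by left; exists B.
- by right; exists B.
- by exists B; split=> //; left.
- by exists B; split=> //; right.
Qed.

Lemma mseq0l R : mseq set0 R = set0.
Proof. by apply: multirel_ext => a A; split=> // -[B []]. Qed.

Lemma mparA R S T : mpar R (mpar S T) = mpar (mpar R S) T.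
Proof.
apply: multirel_ext => a D; split.
  move=> [A [BC [RA [B [C [SB TC /= ->]]] /= ->]]]; exists (A `|` B), C.
  by rewrite setUA; split=> //; exists A, B.
move=> [AB [C [[A [B [RA SB /= ->]]] TC /= ->]]]; exists A, (B `|` C).
by rewrite -setUA; split=> //; exists B, C.
Qed.

Lemma mparC R S : mpar R S = mpar S R.
Proof.
by apply: multirel_ext => a C; split=> -[A [B [HA HB /= ->]]];
  exists B, A; rewrite setUC.
Qed.

Lemma mpar1l R : mpar (mone_pi X) R = R.
Proof.
apply: multirel_ext => a A; split=> [[B [C [B0 RC /= ->]]]|RA].
  by rewrite [B]B0 set0U.
by exists set0, A; rewrite set0U.
Qed.

Lemma mparUr R S T : mpar R (S `|` T) = mpar R S `|` mpar R T.
Proof.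
apply: multirel_ext => a C; split.
  by move=> [A [B [RA [HB|HB] CE]]]; [left|right]; exists A, B.
by move=> [[A [B [RA HB CE]]]|[A [B [RA HB CE]]]]; exists A, B;
  split=> //; [left|right].
Qed.

Lemma mpar0r R : mpar R set0 = set0.
Proof. by apply: multirel_ext => a A; split=> // -[B [C []]]. Qed.

Lemma mseqA_subidl P S T : mseq (subid P) (mseq S T) = mseq (mseq (subid P) S) T.
Proof.
apply: multirel_ext => a A; rewrite mseq_subidl; split.
  by move=> [Pa [B [SB Bf]]]; exists B; rewrite mseq_subidl.
by move=> [B [/mseq_subidl[Pa SB] Bf]]; split=> //; exists B.
Qed.

(** Either bracketing asks that the intermediate set [B] reached by [R] lie in [P]. *)
Lemma mseqA_subidm R P T : mseq R (mseq (subid P) T) = mseq (mseq R (subid P)) T.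
Proof.
apply: multirel_ext => a A; split.
  move=> [B [RB [f [fT AE]]]]; exists B; rewrite mseq_subidr; split.
    by split=> // b /fT/mseq_subidl[].
  by exists f; split=> // b /fT/mseq_subidl[].
move=> [B [/mseq_subidr[RB BP] [f [fT AE]]]]; exists B; split=> //.
by exists f; split=> // b Bb; apply/mseq_subidl; split; [exact: BP|exact: fT].
Qed.

(** A union lies in [P] exactly when each of its members does, so the restriction passes between the
    sets [f b] and their union. *)
Lemma mseqA_subidr R S P : mseq R (mseq S (subid P)) = mseq (mseq R S) (subid P).
Proof.
apply: multirel_ext => a A; rewrite mseq_subidr; split.
  move=> [B [RB [f [fS AE]]]]; split.
    by exists B; split=> //; exists f; split=> // b /fS/mseq_subidr[].
  by rewrite [A]AE => c [b /fS/mseq_subidr[_ fP]] /fP.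
move=> [[B [RB [f [fS AE]]]] AP]; exists B; split=> //; exists f; split=> //.
move=> b Bb; apply/mseq_subidr; split; first exact: fS.
by move=> c fc; apply: AP; rewrite [A]AE; exists b.
Qed.

Lemma mpar_mseq_subid R S P :
  mseq (mpar R S) (subid P) = mpar (mseq R (subid P)) (mseq S (subid P)).
Proof.
apply: multirel_ext => a C; rewrite mseq_subidr; split.
  move=> [[A [B [RA SB /= ->]]]]; rewrite subUset => -[AP BP]; exists A, B.
  by split=> //; apply/mseq_subidr.
move=> [A [B [/mseq_subidr[RA AP] /mseq_subidr[SB BP] /= ->]]].
by split; [exists A, B|rewrite subUset].
Qed.

Lemma mpar_subid P Q : mpar (subid P) (subid Q) = mseq (subid P) (subid Q).
Proof.
apply: multirel_ext => a A; rewrite mseq_subidl; split.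
  by move=> [B [C [[/= -> Pa] [/= -> Qa] /= ->]]]; rewrite setUid.
by move=> [Pa [/= -> Qa]]; exists [set a], [set a]; rewrite setUid.
Qed.

(** [mstarP] gives leastness among fixpoints only. As in Knaster-Tarski, the intersection [L] of all
    pre-fixpoints is itself a fixpoint, hence contains [mstar R], and [L] lies in [T]. *)
Lemma mstar_ind R T : mstar_fun R T `<=` T -> mstar R `<=` T.
Proof.
move=> leT; have [_ leastS] := mstarP R.
pose L := \bigcap_(T in [set T | mstar_fun R T `<=` T]) T.
have leL : mstar_fun R L `<=` L.
  by move=> p FLp S FS; apply: (FS); apply: mstar_fun_mono FLp => q; exact.
have FL : mstar_fun R L = L.
  by apply/seteqP; split=> // p; apply; exact: mstar_fun_mono.
by move=> p /(leastS _ FL); exact.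
Qed.

Lemma mstar_subid_ind R S P :
  subid P `|` mseq R S `<=` S -> mseq (mstar R) (subid P) `<=` S.
Proof.
move=> leS; pose T : multirel X := [set p | p.2 `<=` P -> S p].
suff starT : mstar R `<=` T by move=> [a A] /mseq_subidr[/starT].
apply: mstar_ind => -[a A] [A1|[B [RB [f [fT /= AE]]]]] AP; apply: leS.
  by left; split=> //; apply: AP; rewrite /= [A]A1.
(* Each [f b] is part of the union [A], so it inherits inclusion in [P] and the implication defining
   [T] applies to it. *)
right; exists B; split=> //; exists f; split=> // b Bb; apply: fT => //.
by move=> c fc; apply: AP; rewrite /= AE; exists b.
Qed.

End Multirelations.

Theorem theorem11p6 (X : Type) :
  @is_ap_bi_Kleene_algebra (multirel X) setU (@mseq X) (@mpar X)
    set0 (mone_sigma X) (mone_pi X) (@mantidom X) (@mstar X).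
Proof.
split.
- exact: setUA.
- exact: setUC.
- exact: setUid.
- exact: set0U.
- exact: mseq1l.
- exact: mseq1r.
- move=> R S T; apply/setUidPr; rewrite subUset; split; apply: mseqS.
    exact: subsetUl.
  exact: subsetUr.
- exact: mseqUl.
- exact: mseq0l.
- exact: mparA.
- exact: mparC.
- exact: mpar1l.
- exact: mparUr.
- exact: mpar0r.
- move=> R S T [] [w ->]; rewrite mantidomE.
  + exact: mseqA_subidl.
  + exact: mseqA_subidm.
  + exact: mseqA_subidr.
- move=> R; apply: multirel_ext => a A; rewrite mantidomE mseq_subidl.
  by split=> // -[nR RA]; apply: nR; exists A.
(* Both sides become the subidentity on the points from which [R] reaches no subset of [dom S]. *)
- by move=> R S; rewrite mantidomK !mantidomE !dom_mseq dom_subid.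
- by move=> R; rewrite mantidomK mantidomE subidU setUC setUv subid_setT.
(* In a general product, different points of [B] may use different summands; a subidentity reaches
   only singletons, so a single summand is used. *)
- move=> R S T; rewrite mantidomE; apply: multirel_ext => a A.
  rewrite mseq_subidl; split=> [[nR [HA|HA]]|[]/mseq_subidl[nR HA]].
  + by left; apply/mseq_subidl.
  + by right; apply/mseq_subidl.
  + by split=> //; left.
  + by split=> //; right.
- by move=> R S T; rewrite mantidomE mpar_mseq_subid.
(* De Morgan applied to [dom R] and [dom S]. *)
- by move=> R S; rewrite !mantidomE subidU dom_mpar setCI.
- by move=> R S; rewrite !mantidomE mpar_subid.
- move=> R; apply/setUidPr; have [starE _] := mstarP R.
  by rewrite -[X in _ `<=` X]starE.
- move=> R S T; rewrite mantidomE => /setUidPr leS.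
  by apply/setUidPr; exact: mstar_subid_ind.
Qed.
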